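(* Let $F$ and $F_1$ be simplices in $\mathbb H^n$ ($n\ge 2$) such that $W_{F_1}\subset W_F$ and $W_{F_1}$ is a maximal proper reflection subgroup of $W_F$. Let $\Delta$ be any hyperbolic root system with fundamental simplex $F$, let $L$ be its root lattice, and let $\Delta^\vee$, $L^\vee$ be the dual root system and its root lattice. Then at least one of the following holds: the roots of $\Delta$ vanishing on the facets of $F_1$ generate a proper sublattice of $L$, or the roots of $\Delta^\vee$ vanishing on the facets of $F_1$ generate a proper sublattice of $L^\vee$.
   Context: A generalized Cartan matrix $A=(a_{ij})$ of size $n+1$ is of hyperbolic type if it is indecomposable, symmetrizable, of indefinite type, and every proper principal submatrix of the corresponding symmetric matrix $B$ is of finite or affine type (componentwise, if decomposable). Then $B$ has signature $(n,1)$. Let $L=\sum_{i=1}^{n+1}\mathbb Z\alpha_i$ be the root lattice, free on the simple roots $\alpha_1,\dots,\alpha_{n+1}$, with the symmetric bilinear form $(\cdot|\cdot)$ given by $B$ (positive on simple roots), so that $a_{ij}=2(\alpha_i|\alpha_j)/(\alpha_i|\alpha_i)$. The Weyl group $W$ is generated by the reflections in the $\alpha_i$. The hyperbolic root system of $A$ (the root system of the Kac-Moody algebra $\mathfrak g(A)$) is $\Delta=\Delta^{re}\cup\Delta^{im}$, with real roots $\Delta^{re}=W(\alpha_1)\cup\dots\cup W(\alpha_{n+1})$ and imaginary roots $\Delta^{im}=\{\alpha\in L : (\alpha|\alpha)\le 0\}$. $W$ acts as a discrete reflection group on the hyperbolic space $\mathbb H^n$ modelled on negative vectors of $L\otimes\mathbb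 R$. Its fundamental chamber $F$, bounded by the hyperplanes $\alpha_i^\perp$ with the $\alpha_i$ as outward normals, is a finite-volume Coxeter simplex, called the fundamental simplex of $\Delta$. A real root vanishes on a facet if that facet lies in the hyperplane orthogonal to the root (such a root is determined up to sign; the outward normal is taken). The dual root system $\Delta^\vee$ is the hyperbolic root system of the transpose $A^t$, with root lattice $L^\vee$. It has the same fundamental simplex and Weyl group as $\Delta$, and may be realized in the same space with simple roots $2\alpha_i/(\alpha_i|\alpha_i)$. ''Simplex'' means a hyperbolic Coxeter simplex of finite volume (ideal vertices allowed) with all dihedral angles in $\{\pi/2,\pi/3,\pi/4,\pi/6\}$; for $n=2$ the angle $0$ is also allowed. For a simplex $P$, $W_P$ is the group generated by the reflections in the facets of $P$. A reflection group is a group generated by reflections; ''maximal proper reflection subgroup of $W_F$'' means maximal by inclusion among proper subgroups of $W_F$ that are reflection groups. *)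

(* Defs.v *)
From HB Require Import structures.
From mathcomp Require Import all_boot all_order all_algebra.
From mathcomp Require Import all_classical all_reals all_analysis.

Set Implicit Arguments.
Unset Strict Implicit.
Unset Printing Implicit Defensive.

Import Order.TTheory GRing.Theory Num.Theory.

Local Open Scope classical_set_scope.
Local Open Scope ring_scope.

(** * Generalized Cartan matrices of hyperbolic type *)

Definition is_gcm m (A : 'M[int]_m) : Prop :=
  [/\ forall i, A i i = 2,
      forall i j, i != j -> A i j <= 0
    & forall i j, A i j = 0 -> A j i = 0].

Definition principal (T : Type) m (M : 'M[T]_m) (I : {set 'I_m}) : 'M[T]_#|I| :=
  mxsub (fun k : 'I_#|I| => enum_val k) (fun k : 'I_#|I| => enum_val k) M.

Definition indecomposable (R : numDomainType) m (M : 'M[R]_m) : Prop :=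
  forall I : {set 'I_m}, (0 < #|I| < m)%N ->
    exists i j, [/\ i \in I, j \notin I & (M i j != 0) || (M j i != 0)].

Definition component (R : numDomainType) m (M : 'M[R]_m) (I : {set 'I_m}) : Prop :=
  [/\ (0 < #|I|)%N, indecomposable (principal M I)
    & forall i j, i \in I -> j \notin I -> M i j = 0 /\ M j i = 0].

(** The trichotomy of Kac (Infinite dimensional Lie algebras, Theorem 4.3),
    meant for indecomposable matrices with nonpositive off-diagonal entries.
    It is insensitive to multiplying rows by positive numbers, so that a
    Cartan matrix and its symmetrization have the same type. *)

Definition cv_pos (R : numDomainType) m (v : 'cV[R]_m) : Prop :=
  forall i, 0 < v i 0.

Definition cv_nneg (R : numDomainType) m (v : 'cV[R]_m) : Prop :=
  forall i, 0 <= v i 0.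

Definition finite_type (R : realFieldType) m (M : 'M[R]_m) : Prop :=
  [/\ \det M != 0,
      exists2 u : 'cV[R]_m, cv_pos u & cv_pos (M *m u)
    & forall v : 'cV[R]_m, cv_nneg (M *m v) -> cv_pos v \/ v = 0].

Definition affine_type (R : realFieldType) m (M : 'M[R]_m) : Prop :=
  [/\ (\rank M).+1 = m,
      exists2 u : 'cV[R]_m, cv_pos u & M *m u = 0
    & forall v : 'cV[R]_m, cv_nneg (M *m v) -> M *m v = 0].

Definition indefinite_type (R : realFieldType) m (M : 'M[R]_m) : Prop :=
  (exists2 u : 'cV[R]_m, cv_pos u & cv_pos (- (M *m u))) /\
  (forall v : 'cV[R]_m, cv_nneg (M *m v) -> cv_nneg v -> v = 0).

Definition symmetrization (R : realFieldType) m
    (A : 'M[int]_m) (B : 'M[R]_m) : Prop :=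
  [/\ B^T = B, forall i, 0 < B i i
    & forall i j, (A i j)%:~R = 2 * B i j / B i i].

(** For indecomposable [A] the matrix [B] below is unique up to a positive
    factor. *)
Definition hyperbolic_gcm (R : realFieldType) m (A : 'M[int]_m) : Prop :=
  [/\ is_gcm A, indecomposable A,
      indefinite_type (map_mx intr A : 'M[R]_m)
    & exists2 B : 'M[R]_m, symmetrization A B &
        forall I : {set 'I_m}, (#|I| < m)%N ->
        forall J : {set 'I_#|I|}, component (principal B I) J ->
          finite_type (principal (principal B I) J) \/
          affine_type (principal (principal B I) J)].

(** * Hyperbolic space and reflection groups *)

(** Vectors are rows, and linear maps act on them by right multiplication.
    The last coordinate is the negative one. *)
Definition lorentz (R : realType) n : 'M[R]_n.+1 :=
  diag_mx (\row_i (if i == ord_max then -1 else 1)).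

Definition mink (R : realType) n (x y : 'rV[R]_n.+1) : R :=
  (x *m lorentz R n *m y^T) 0 0.

Definition hyp (R : realType) n : set 'rV[R]_n.+1 :=
  [set x | mink x x = -1 /\ 0 < x 0 ord_max].

Definition refl (R : realType) n (e : 'rV[R]_n.+1) : 'M[R]_n.+1 :=
  1%:M - (2 / mink e e) *: (lorentz R n *m e^T *m e).

Lemma reflE (R : realType) n (e x : 'rV[R]_n.+1) :
  x *m refl e = x - (2 * mink x e / mink e e) *: e.
Proof.
rewrite /refl mulmxBr mulmx1 -scalemxAr !mulmxA.
rewrite [x *m _ *m e^T]mx11_scalar mul_scalar_mx scalerA.
by rewrite -/(mink x e) mulrAC.
Qed.

Definition subgroup (R : realType) n (G : set 'M[R]_n.+1) : Prop :=
  [/\ forall g, G g -> g \is a GRing.unit,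
      G 1,
      forall g h, G g -> G h -> G (g * h)
    & forall g, G g -> G g^-1].

Definition generated (R : realType) n (S : set 'M[R]_n.+1) : set 'M[R]_n.+1 :=
  smallest (@subgroup R n) S.

(** Hyperplanes of hyperbolic space are the orthogonal complements of the
    vectors of positive square. *)
Definition reflections (R : realType) n : set 'M[R]_n.+1 :=
  [set refl e | e in [set e : 'rV[R]_n.+1 | 0 < mink e e]].

Definition reflection_group (R : realType) n (G : set 'M[R]_n.+1) : Prop :=
  exists2 S : set 'M[R]_n.+1, S `<=` @reflections R n & G = generated S.

Definition maximal_proper_reflection_subgroup (R : realType) n
    (G W : set 'M[R]_n.+1) : Prop :=
  [/\ reflection_group G, G `<` W
    & forall H, reflection_group H -> G `<=` H -> H `<` W -> H = G].

(** * Simplices *)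

(** A simplex of dimension [n] is given by a family [p] of [n.+1] linearly
    independent vectors of the closed future cone: the ray spanned by [p i] is
    a point of hyperbolic space if [p i] has negative square, and an ideal
    point if [p i] is isotropic.  The convex hulls of such families are exactly
    the simplices of finite volume. *)

Definition hull (R : realType) n (p : 'I_n.+1 -> 'rV[R]_n.+1)
    : set 'rV[R]_n.+1 :=
  [set x | hyp x /\ exists2 c : 'I_n.+1 -> R,
     forall i, 0 <= c i & x = \sum_i c i *: p i].

(** The facet opposite to the vertex [p j]. *)
Definition facet (R : realType) n (p : 'I_n.+1 -> 'rV[R]_n.+1) (j : 'I_n.+1)
    : set 'rV[R]_n.+1 :=
  [set x | hyp x /\ exists2 c : 'I_n.+1 -> R,
     (forall i, 0 <= c i) /\ c j = 0 & x = \sum_i c i *: p i].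

Definition outward_normal (R : realType) n (p : 'I_n.+1 -> 'rV[R]_n.+1)
    (j : 'I_n.+1) (u : 'rV[R]_n.+1) : Prop :=
  [/\ 0 < mink u u,
      forall x, facet p j x -> mink x u = 0
    & forall x, hull p x -> mink x u <= 0].

(** The interior angle between two facets with outward normals [u] and [v];
    it is [0] when the facets only meet at an ideal point. *)
Definition dihedral_angle (R : realType) n (u v : 'rV[R]_n.+1) : R :=
  acos (- mink u v / (Num.sqrt (mink u u) * Num.sqrt (mink v v))).

Definition coxeter_simplex (R : realType) n (p : 'I_n.+1 -> 'rV[R]_n.+1)
    : Prop :=
  [/\ forall i, mink (p i) (p i) <= 0 /\ 0 < p i 0 ord_max,
      row_free (\matrix_i p i)
    & forall i j u v, i != j -> outward_normal p i u -> outward_normal p j v ->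
        dihedral_angle u v \in [:: pi / 2; pi / 3; pi / 4; pi / 6] \/
        (n = 2%N /\ dihedral_angle u v = 0)].

Definition simplex_group (R : realType) n (p : 'I_n.+1 -> 'rV[R]_n.+1)
    : set 'M[R]_n.+1 :=
  generated [set refl u | u in [set u | exists j, outward_normal p j u]].

(** * Hyperbolic root systems *)

(** A root system is given by its Cartan matrix and its simple roots, realized
    in the Lorentzian space containing the hyperbolic space. *)
Definition hyperbolic_root_system (R : realType) n (A : 'M[int]_n.+1)
    (alpha : 'I_n.+1 -> 'rV[R]_n.+1) : Prop :=
  [/\ hyperbolic_gcm R A,
      row_free (\matrix_i alpha i),
      forall i, 0 < mink (alpha i) (alpha i)
    & forall i j, (A i j)%:~R =
        2 * mink (alpha i) (alpha j) / mink (alpha i) (alpha i)].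

(** The facets of the fundamental simplex are numbered like the simple roots. *)
Definition fundamental_simplex (R : realType) n
    (alpha p : 'I_n.+1 -> 'rV[R]_n.+1) : Prop :=
  forall i, outward_normal p i (alpha i).

Definition weyl_group (R : realType) n (alpha : 'I_n.+1 -> 'rV[R]_n.+1)
    : set 'M[R]_n.+1 :=
  generated (range (fun i => refl (alpha i))).

Definition real_roots (R : realType) n (alpha : 'I_n.+1 -> 'rV[R]_n.+1)
    : set 'rV[R]_n.+1 :=
  [set b | exists i w, weyl_group alpha w /\ b = alpha i *m w].

(** Simple roots of the dual root system, whose Cartan matrix is the transpose. *)
Definition dual_simple (R : realType) n (alpha : 'I_n.+1 -> 'rV[R]_n.+1)
    (i : 'I_n.+1) : 'rV[R]_n.+1 :=
  (2 / mink (alpha i) (alpha i)) *: alpha i.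

Definition additive_subgroup (V : zmodType) (G : set V) : Prop :=
  G 0 /\ forall x y, G x -> G y -> G (x - y).

Definition lattice (V : zmodType) (S : set V) : set V :=
  smallest (@additive_subgroup V) S.

Definition root_lattice (R : realType) n (alpha : 'I_n.+1 -> 'rV[R]_n.+1)
    : set 'rV[R]_n.+1 :=
  lattice (range alpha).

(** Imaginary roots have nonpositive square, so only real roots can vanish on
    a facet. *)
Definition facet_roots (R : realType) n (alpha p : 'I_n.+1 -> 'rV[R]_n.+1)
    : set 'rV[R]_n.+1 :=
  [set b | real_roots alpha b /\ exists j, outward_normal p j b].

(* Main.v *)
Require Import Defs.
From mathcomp Require Import all_boot all_order all_algebra.
From mathcomp Require Import all_classical all_reals all_analysis.
From mathcomp Require Import ring lra.

Set Implicit Arguments.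
Unset Strict Implicit.
Unset Printing Implicit Defensive.

Import Order.TTheory GRing.Theory Num.Theory.

Local Open Scope classical_set_scope.
Local Open Scope ring_scope.

(** The real roots of a hyperbolic root system can be read off from its two
    root lattices: [x] in [L] is a real root if and only if [(x|x) > 0] and the
    coroot [2x / (x|x)] lies in the dual lattice (Kac, Infinite dimensional Lie
    algebras, Proposition 5.10; the nontrivial direction is
    [real_root_criterion]).  Two root systems that share both lattices
    therefore have the same real roots and the same Weyl group.

    Suppose now that neither of the two lattices attached to [F1] is proper.
    Every facet of [F1] then carries a real root, since otherwise all facet
    roots, hence all of [L], would be orthogonal to the opposite vertex; and it
    carries only one, since real roots are primitive in [L]
    ([real_root_unique]).  Call these roots [beta].  Their Cartan integers are
    integral because they are real roots, and they form obtuse angles because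
    the dihedral angles of [F1] are at most [pi / 2]
    ([coxeter_simplex_obtuse]).  They generate [L], and their coroots generate
    the dual lattice.  So every [alpha i] satisfies the criterion with respect
    to [beta], its reflection belongs to the group of [F1], and that group is
    not a proper subgroup of the group of [F].

    The criterion rests on a statement about signs ([admissible_sign]): if [x]
    in [L] has [N = (x|x) > 0] and its coroot is in the dual lattice, then the
    coefficients of [x] on the simple roots all have the same sign.  Indeed
    write [x = a - b] with [a] and [b] nonnegative, of disjoint supports.  The
    integrality makes [(a|a)] and [(b|b)] multiples of [N].  A combination that
    omits a simple root is orthogonal to a vertex of the chamber, a timelike or
    lightlike vector, so its square is nonnegative, and it vanishes only along
    an ideal vertex.  If [a] and [b] are both nonzero, neither is null, and
    [N = (a|a) + (b|b) - 2(a|b) >= 2N], which is absurd.  Once signs agree,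
    simple reflections lower the height of a positive [x] until it is a simple
    root. *)

(** * The Lorentzian form *)

Section Lorentz.
Variables (R : realType) (n : nat).
Implicit Types (x y p q u v : 'rV[R]_n.+1).

Lemma minkE x y :
  mink x y = \sum_(i | i != ord_max) x 0 i * y 0 i - x 0 ord_max * y 0 ord_max.
Proof.
rewrite /mink /lorentz mul_mx_diag mxE (bigD1 ord_max) //= addrC; congr (_ + _).
  by apply: eq_bigr => i ni; rewrite !mxE (negbTE ni) mulr1.
by rewrite !mxE eqxx mulrN1 mulNr.
Qed.

Lemma minkC x y : mink x y = mink y x.
Proof.
by rewrite !minkE mulrC; congr (_ - _); apply: eq_bigr => i _; rewrite mulrC.
Qed.

Lemma minkDl x y z : mink (x + y) z = mink x z + mink y z.
Proof. by rewrite /mink !mulmxDl mxE. Qed.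

Lemma minkZl a x y : mink (a *: x) y = a * mink x y.
Proof. by rewrite /mink -!scalemxAl mxE. Qed.

Lemma mink0l x : mink 0 x = 0.
Proof. by rewrite -(scale0r (0 : 'rV[R]_n.+1)) minkZl mul0r. Qed.

Lemma minkNl x y : mink (- x) y = - mink x y.
Proof. by rewrite -scaleN1r minkZl mulN1r. Qed.

Lemma minkBl x y z : mink (x - y) z = mink x z - mink y z.
Proof. by rewrite minkDl minkNl. Qed.

Lemma mink_suml (I : Type) (r : seq I) (P : pred I) (f : I -> 'rV[R]_n.+1) y :
  mink (\sum_(i <- r | P i) f i) y = \sum_(i <- r | P i) mink (f i) y.
Proof.
by apply: (big_morph (fun x => mink x y)) => [a b|]; rewrite ?minkDl ?mink0l.
Qed.

Lemma minkDr x y z : mink z (x + y) = mink z x + mink z y.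
Proof. by rewrite !(minkC z) minkDl. Qed.

Lemma minkZr a x y : mink x (a *: y) = a * mink x y.
Proof. by rewrite !(minkC x) minkZl. Qed.

Lemma mink0r x : mink x 0 = 0.
Proof. by rewrite minkC mink0l. Qed.

Lemma minkNr x y : mink x (- y) = - mink x y.
Proof. by rewrite !(minkC x) minkNl. Qed.

Lemma minkBr x y z : mink z (x - y) = mink z x - mink z y.
Proof. by rewrite minkDr minkNr. Qed.

Lemma mink_sumr (I : Type) (r : seq I) (P : pred I) (f : I -> 'rV[R]_n.+1) y :
  mink y (\sum_(i <- r | P i) f i) = \sum_(i <- r | P i) mink y (f i).
Proof. by rewrite minkC mink_suml; apply: eq_bigr => i _; rewrite minkC. Qed.

Lemma mink_ge0 x : x 0 ord_max = 0 -> 0 <= mink x x ?= iff (x == 0).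
Proof.
move=> x0; rewrite minkE x0 mulr0 subr0; split.
  by apply: sumr_ge0 => i _; rewrite -expr2 sqr_ge0.
rewrite eq_sym psumr_eq0 => [|i _]; last by rewrite -expr2 sqr_ge0.
apply/allP/eqP => [H|-> i _]; last by rewrite mxE mul0r eqxx implybT.
apply/rowP => i; rewrite [RHS]mxE; have [->//|ni] := eqVneq i ord_max.
have := H i (mem_index_enum i); rewrite ni /= mulf_eq0 orbb.
by move/eqP.
Qed.

Lemma mink_nondeg v : (forall x, mink x v = 0) -> v = 0.
Proof.
move=> H; apply/rowP => i; rewrite mxE.
have := H (delta_mx 0 i); rewrite minkE.
have [->|ni] := eqVneq i ord_max.
  rewrite big1 => [|j nj]; rewrite !mxE ?eqxx ?(negbTE nj) ?andbF ?mul0r //=.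
  by rewrite mul1r sub0r => /eqP; rewrite oppr_eq0 => /eqP.
rewrite (bigD1 i) //= big1 => [|j /andP[_ nj]].
  rewrite !mxE !eqxx eq_sym (negbTE ni) andbF mul0r subr0 addr0 mul1r.
  exact.
by rewrite !mxE (negbTE nj) andbF mul0r.
Qed.

Lemma mink_basis_eq0 (p : 'I_n.+1 -> 'rV[R]_n.+1) v :
  row_free (\matrix_i p i) -> (forall i, mink (p i) v = 0) -> v = 0.
Proof.
rewrite row_free_unit => up pv; apply: mink_nondeg => x.
rewrite -(mulmxKV up x) mulmx_sum_row mink_suml big1 // => i _.
by rewrite minkZl rowK pv mulr0.
Qed.

(** Nonzero vectors of the closed future cone: the vertices of a simplex, ideal
    or not. *)
Definition future p : Prop := mink p p <= 0 /\ 0 < p 0 ord_max.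

(** The combination [p_n v - v_n p] has no time component, so its square is
    nonnegative; when [p] and [v] are orthogonal that square is
    [p_n^2 (v|v) + v_n^2 (p|p)], whose second term is nonpositive.  The same
    combination serves in the next two lemmas. *)
Lemma future_orth p v : future p -> mink p v = 0 -> 0 <= mink v v.
Proof.
move=> [pp p0] pv.
pose w := p 0 ord_max *: v - v 0 ord_max *: p.
have w0 : w 0 ord_max = 0 by rewrite !mxE mulrC subrr.
have [+ _] := mink_ge0 w0.
rewrite /w !(minkBl, minkBr, minkZl, minkZr) (minkC v p) pv.
have : v 0 ord_max ^+ 2 * mink p p <= 0 by rewrite mulr_ge0_le0 ?sqr_ge0.
move=> vp wge; rewrite -(pmulr_rge0 _ (exprn_gt0 2 p0)).
lra.
Qed.

Lemma future_orth_null p v :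
  future p -> mink p v = 0 -> mink v v = 0 -> exists t, v = t *: p.
Proof.
move=> [pp p0] pv vv.
pose w := p 0 ord_max *: v - v 0 ord_max *: p.
have w0 : w 0 ord_max = 0 by rewrite !mxE mulrC subrr.
have [wge weq] := mink_ge0 w0.
have ww : mink w w = v 0 ord_max ^+ 2 * mink p p.
  rewrite /w !(minkBl, minkBr, minkZl, minkZr) (minkC v p) pv vv.
  ring.
have : w == 0.
  rewrite -weq eq_le wge /= ww; apply: mulr_ge0_le0 => //; exact: sqr_ge0.
rewrite subr_eq0 => /eqP e.
exists ((p 0 ord_max)^-1 * v 0 ord_max).
by rewrite -scalerA -e scalerA mulVf ?scale1r // gt_eqF.
Qed.

Lemma future_mink p q : future p -> future q ->
  mink p q <= 0 /\ (mink p q = 0 -> exists t, q = t *: p).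
Proof.
move=> [pp p0] [qq q0].
pose w := p 0 ord_max *: q - q 0 ord_max *: p.
have w0 : w 0 ord_max = 0 by rewrite !mxE mulrC subrr.
have [wge weq] := mink_ge0 w0.
have ww : mink w w = p 0 ord_max ^+ 2 * mink q q + q 0 ord_max ^+ 2 * mink p p
   - 2 * (p 0 ord_max * q 0 ord_max) * mink p q.
  rewrite /w !(minkBl, minkBr, minkZl, minkZr) (minkC q p).
  ring.
have pq0 : 0 < p 0 ord_max * q 0 ord_max by rewrite mulr_gt0.
have h1 : p 0 ord_max ^+ 2 * mink q q <= 0 by rewrite mulr_ge0_le0 ?sqr_ge0.
have h2 : q 0 ord_max ^+ 2 * mink p p <= 0 by rewrite mulr_ge0_le0 ?sqr_ge0.
split; first by rewrite -(pmulr_rle0 _ pq0); lra.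
move=> pq; have : w == 0 by rewrite -weq eq_le wge /= ww pq; lra.
rewrite subr_eq0 => /eqP e.
exists ((p 0 ord_max)^-1 * q 0 ord_max).
by rewrite -scalerA -e scalerA mulVf ?scale1r // gt_eqF.
Qed.

End Lorentz.

(** * Reflections and the groups they generate *)

Section Reflections.
Variables (R : realType) (n : nat).
Implicit Types (x y e u v : 'rV[R]_n.+1) (g h w : 'M[R]_n.+1).

Lemma refl_self e : mink e e != 0 -> e *m refl e = - e.
Proof. by move=> e0; rewrite reflE mulfK // scaler_nat mulr2n opprD addNKr. Qed.

Lemma refl_mink e x y : mink e e != 0 ->
  mink (x *m refl e) (y *m refl e) = mink x y.
Proof.
move=> e0; rewrite !reflE !(minkBl, minkBr, minkZl, minkZr) (minkC e y).
by field.
Qed.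

Lemma row_ext g h : (forall x, x *m g = x *m h) -> g = h.
Proof. by move=> H; apply/row_matrixP => i; rewrite !rowE H. Qed.

Lemma reflK e : mink e e != 0 -> refl e * refl e = 1.
Proof.
move=> e0; apply: row_ext => x; rewrite mulmxA mulmx1 [x *m refl e]reflE.
rewrite mulmxBl -scalemxAl refl_self // reflE scalerN opprK.
by rewrite subrK.
Qed.

Lemma refl_unit e : mink e e != 0 -> refl e \is a GRing.unit.
Proof. by move=> e0; apply/unitrP; exists (refl e); rewrite reflK. Qed.

Lemma reflV e : mink e e != 0 -> (refl e)^-1 = refl e.
Proof.
by move=> e0; rewrite -[LHS](mulr1) -(reflK e0) mulKr // refl_unit.
Qed.

Lemma reflZ a e : a != 0 -> refl (a *: e) = refl e.
Proof.
move=> a0; apply: row_ext => x; rewrite !reflE !(minkZl, minkZr) scalerA.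
congr (_ - _ *: _).
have [->|e0] := eqVneq (mink e e) 0.
  by rewrite !mulr0 !invr0 !mulr0 mul0r.
by field; rewrite a0 e0.
Qed.

Definition isometry g := g \is a GRing.unit /\
  forall x y, mink (x *m g) (y *m g) = mink x y.

Lemma isometryV g : isometry g -> isometry g^-1.
Proof.
move=> [ug ig]; split; first by rewrite unitrV.
by move=> x y; rewrite -ig !mulmxKV.
Qed.

Lemma refl_conj g e : isometry g -> refl (e *m g) = g^-1 * refl e * g.
Proof.
move=> ig; have [ug _] := ig; have [_ iV] := isometryV ig.
apply: row_ext => x; rewrite !mulmxA [x *m _ *m refl e]reflE mulmxBl.
rewrite mulmxKV // reflE -scalemxAl.
by rewrite -iV mulmxK // -[mink e e]ig.2.
Qed.

Lemma generated_sub (S : set 'M[R]_n.+1) : S `<=` generated S.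
Proof. exact: sub_smallest. Qed.

Lemma generated_subgroup (S : set 'M[R]_n.+1) :
  (forall g, S g -> g \is a GRing.unit) -> subgroup (generated S).
Proof.
move=> SU; split.
- move=> g /(_ [set g | g \is a GRing.unit]); apply; split => //; split => //.
  + exact: unitr1.
  + by move=> a b /= ua ub; rewrite unitrMl.
  + by move=> a /=; rewrite unitrV.
- by move=> H [[]].
- move=> g h Gg Gh H HH; have [[_ _ M _] _] := HH.
  by apply: M; [apply: Gg|apply: Gh].
- by move=> g Gg H HH; have [[_ _ _ V] _] := HH; apply: V; apply: Gg.
Qed.

End Reflections.

(** * Root lattices and real roots *)

Lemma int_ge1 (R : realType) (c : R) : 0 < c -> c \is a Num.int -> 1 <= c.
Proof. by move=> c0 ci; rewrite -(gtr0_norm c0) norm_intr_ge1 // gt_eqF. Qed.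

Lemma int_inv_int (R : realType) (c : R) : 0 < c ->
  c \is a Num.int -> c^-1 \is a Num.int -> c = 1.
Proof.
move=> c0 ci Vi; apply/eqP; rewrite eq_le int_ge1 // andbT -invf_ge1 //.
by apply: int_ge1; rewrite ?invr_gt0.
Qed.

Lemma additive_subgroupN (V : zmodType) (G : set V) x :
  additive_subgroup G -> G x -> G (- x).
Proof. by move=> [G0 GB] Gx; rewrite -sub0r; apply: GB. Qed.

Lemma additive_subgroupD (V : zmodType) (G : set V) x y :
  additive_subgroup G -> G x -> G y -> G (x + y).
Proof.
move=> GG Gx Gy; rewrite -[y]opprK.
by apply: GG.2 => //; apply: additive_subgroupN.
Qed.

Section Roots.
Variables (R : realType) (n : nat) (e : 'I_n.+1 -> 'rV[R]_n.+1).
Implicit Types (x y u v : 'rV[R]_n.+1) (g h w : 'M[R]_n.+1).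

Definition comb (k : 'I_n.+1 -> R) : 'rV[R]_n.+1 := \sum_i k i *: e i.

Lemma root_latticeP x : root_lattice e x <->
  exists2 k, (forall i, k i \is a Num.int) & x = comb k.
Proof.
split=> [|[k kint ->]].
  move=> /(_ [set x | exists2 k, (forall i, k i \is a Num.int) & x = comb k]).
  apply; split; first split.
  - exists (fun=> 0) => [i|]; first exact: rpred0.
    by rewrite /comb big1 // => i _; rewrite scale0r.
  - move=> _ _ [k ki ->] [l li ->]; exists (fun i => k i - l i) => [i|].
      exact: rpredB.
    by rewrite /comb -sumrB; apply: eq_bigr => i _; rewrite scalerBl.
  - move=> _ [i _ <-]; exists (fun j => (j == i)%:R) => [j|].
      by case: eqP => _; rewrite ?rpred0 ?rpred1.
    rewrite /comb (bigD1 i) //= eqxx scale1r big1 ?addr0 // => j /negbTE ->.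
    by rewrite scale0r.
move=> G [GG Ge]; rewrite /comb; elim/big_ind: _ => [|x0 y0|i _].
- exact: GG.1.
- exact: additive_subgroupD.
have /intrP[m ->] := kint i.
have Gei : G (e i) by apply: Ge; exists i.
have Gn d : G (d%:R *: e i).
  elim: d => [|d IH]; first by rewrite scale0r; exact: GG.1.
  by rewrite mulrSr scalerDl scale1r; apply: additive_subgroupD.
case: m => d; first exact: Gn.
by rewrite NegzE rmorphN /= scaleNr; apply: additive_subgroupN => //; exact: Gn.
Qed.

Lemma root_lattice_gen i : root_lattice e (e i).
Proof. by move=> G [_]; apply; exists i. Qed.

Lemma root_lattice_group : additive_subgroup (root_lattice e).
Proof.
split; first by move=> G [[]].
by move=> x y Lx Ly G HG; have [[_ B] _] := HG; apply: B; [apply: Lx|apply: Ly].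
Qed.

Lemma root_lattice_scale m x : m \is a Num.int ->
  root_lattice e x -> root_lattice e (m *: x).
Proof.
move=> mi /root_latticeP[k ki ->]; apply/root_latticeP.
exists (fun i => m * k i) => [i|]; first by rewrite rpredM.
by rewrite /comb scaler_sumr; apply: eq_bigr => i _; rewrite scalerA.
Qed.

Definition crystallographic : Prop :=
  (forall i, 0 < mink (e i) (e i)) /\
  forall i j, 2 * mink (e i) (e j) / mink (e i) (e i) \is a Num.int.

Hypothesis ecr : crystallographic.

Let epos i : 0 < mink (e i) (e i). Proof. exact: ecr.1. Qed.
Let enz i : mink (e i) (e i) != 0. Proof. by rewrite gt_eqF. Qed.
Hint Resolve enz : core.

Lemma pairing_int i x : root_lattice e x ->
  2 * mink (e i) x / mink (e i) (e i) \is a Num.int.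
Proof.
move=> /root_latticeP[k ki ->]; rewrite /comb mink_sumr mulr_sumr mulr_suml.
apply: rpred_sum => j _; rewrite minkZr mulrCA -mulrA rpredM //.
exact: ecr.2.
Qed.

Lemma weyl_subgroup : subgroup (weyl_group e).
Proof.
by apply: generated_subgroup => _ [i _ <-]; exact: refl_unit.
Qed.

Lemma weyl_refl i : weyl_group e (refl (e i)).
Proof. by apply: generated_sub; exists i. Qed.

Lemma root_lattice_refl i x : root_lattice e x ->
  root_lattice e (x *m refl (e i)).
Proof.
move=> Lx; rewrite reflE; apply: root_lattice_group.2 => //.
apply: root_lattice_scale; last exact: root_lattice_gen.
by rewrite minkC; apply: pairing_int.
Qed.

Lemma weyl_isometry w : weyl_group e w -> isometry w.
Proof.
move=> /(_ [set g | isometry g]); apply; split; first split.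
- by move=> g [].
- by split=> [|x y]; rewrite ?unitr1 ?mulmx1.
- move=> g h [ug ig] [uh ih]; split; first by rewrite unitrMl.
  by move=> x y; rewrite !mulmxA ih ig.
- exact: isometryV.
- by move=> _ [i _ <-]; split => [|x y]; [apply: refl_unit|rewrite refl_mink].
Qed.

(** Both [g] and its inverse have to be tracked, for the stabilizer of a
    lattice in the sense of inclusion is not closed under inverses. *)
Lemma weyl_lattice w x : weyl_group e w -> root_lattice e x ->
  root_lattice e (x *m w).
Proof.
move=> Ww; pose H := [set g : 'M[R]_n.+1 | g \is a GRing.unit /\
  forall x, root_lattice e x -> root_lattice e (x *m g) /\
    root_lattice e (x *m g^-1)].
suff [_ Hw] : H w by case/Hw.
apply: Ww; split; first split.
- by move=> g [].
- by split=> [|y Ly]; rewrite ?unitr1 ?invr1 ?mulmx1.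
- move=> g h [ug Hg] [uh Hh]; split; first by rewrite unitrMl.
  move=> y Ly; rewrite invrM // !mulmxA; split.
    by apply: (Hh _ _).1; apply: (Hg _ Ly).1.
  by apply: (Hg _ _).2; apply: (Hh _ Ly).2.
- move=> g [ug Hg]; split; first by rewrite unitrV.
  by move=> y Ly; rewrite invrK; case: (Hg _ Ly).
- move=> _ [i _ <-]; split; first exact: refl_unit.
  by move=> y Ly; rewrite reflV //; split; apply: root_lattice_refl.
Qed.

Lemma weylV w : weyl_group e w -> weyl_group e w^-1.
Proof. by have [_ _ _] := weyl_subgroup; apply. Qed.

Lemma weylM w w' : weyl_group e w -> weyl_group e w' -> weyl_group e (w * w').
Proof. by have [_ _ M _] := weyl_subgroup; apply: M. Qed.

Lemma real_root_lattice x : real_roots e x -> root_lattice e x.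
Proof.
by move=> [i [w [Ww ->]]]; apply: weyl_lattice => //; exact: root_lattice_gen.
Qed.

Lemma real_root_pos x : real_roots e x -> 0 < mink x x.
Proof. by move=> [i [w [/weyl_isometry[_ iw] ->]]]; rewrite iw. Qed.

Lemma real_root_pairing x y : real_roots e x -> root_lattice e y ->
  2 * mink x y / mink x x \is a Num.int.
Proof.
move=> [i [w [Ww ->]]] Ly; have [uw iw] := weyl_isometry Ww.
rewrite -{1}(mulmxKV uw y) !iw; apply: pairing_int.
exact: weyl_lattice (weylV Ww) Ly.
Qed.

Lemma real_root_refl x : real_roots e x -> weyl_group e (refl x).
Proof.
move=> [i [w [Ww ->]]]; rewrite refl_conj; last exact: weyl_isometry.
by apply: weylM => //; apply: weylM; [exact: weylV|exact: weyl_refl].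
Qed.

(** Transported by the Weyl group to a simple root, which is part of a basis of
    the lattice. *)
Lemma real_root_primitive x c : row_free (\matrix_i e i) ->
  real_roots e x -> root_lattice e (c *: x) -> c \is a Num.int.
Proof.
move=> fe [i [w [Ww ->]]] /(weyl_lattice (weylV Ww)).
have [uw _] := weyl_isometry Ww.
rewrite -scalemxAl mulmxK // => /root_latticeP[k ki ek].
suff -> : c = k i by [].
have : (c *: delta_mx 0 i - \row_j k j) *m (\matrix_i e i) = 0.
  rewrite mulmxBl -scalemxAl -rowE rowK ek mulmx_sum_row /comb -sumrB.
  by apply: big1 => j _; rewrite mxE rowK subrr.
move/eqP; rewrite mulmx_free_eq0 // subr_eq0 => /eqP /rowP /(_ i).
by rewrite !mxE !eqxx mulr1.
Qed.

Lemma real_root_unique x c : row_free (\matrix_i e i) -> 0 < c ->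
  real_roots e x -> real_roots e (c *: x) -> c = 1.
Proof.
move=> fe c0 rx rcx.
have ci := real_root_primitive fe rx (real_root_lattice rcx).
have Vi : c^-1 \is a Num.int.
  apply: (real_root_primitive fe rcx).
  by rewrite scalerA mulVf ?gt_eqF // scale1r; exact: real_root_lattice.
exact: int_inv_int.
Qed.

End Roots.

(** * The dual root system *)

Section Dual.
Variables (R : realType) (n : nat) (e : 'I_n.+1 -> 'rV[R]_n.+1).
Hypothesis ecr : crystallographic e.
Let epos i : 0 < mink (e i) (e i). Proof. exact: ecr.1. Qed.
Let enz i : mink (e i) (e i) != 0. Proof. by rewrite gt_eqF. Qed.

Lemma dual_crystallographic : crystallographic (dual_simple e).
Proof.
split=> [i|i j]; rewrite /dual_simple !(minkZl, minkZr).
  by rewrite !mulr_gt0 ?invr_gt0.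
suff -> : forall a b c : R, a != 0 -> b != 0 ->
    2 * (2 / a * (2 / b * c)) / (2 / a * (2 / a * a)) = 2 * c / b.
- by rewrite minkC; exact: ecr.2.
- exact: enz.
- exact: enz.
by move=> a b c a0 b0; field; rewrite a0 b0.
Qed.

Lemma refl_dual i : refl (dual_simple e i) = refl (e i).
Proof. by rewrite /dual_simple reflZ // gt_eqF // divr_gt0. Qed.

Lemma dual_weyl : weyl_group (dual_simple e) = weyl_group e.
Proof.
rewrite /weyl_group.
suff -> : (fun i => refl (dual_simple e i)) = (fun i => refl (e i)) by [].
by apply/funext => i; exact: refl_dual.
Qed.

(** Coroots are again vectors of the same space, with the same reflections, so
    that the dual real roots are the coroots of the real roots. *)
Lemma dual_real_root b : real_roots (dual_simple e) b <->
  exists2 r, real_roots e r & b = (2 / mink r r) *: r.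
Proof.
rewrite /real_roots dual_weyl; split.
  move=> [i [w [Ww ->]]]; exists (e i *m w); first by exists i, w.
  by have [_ ->] := weyl_isometry ecr Ww; rewrite -scalemxAl.
move=> [_ [i [w [Ww ->]]] ->]; exists i, w; split=> //.
by have [_ ->] := weyl_isometry ecr Ww; rewrite -scalemxAl.
Qed.

Lemma pairing_dual_int x y : root_lattice e x ->
  root_lattice (dual_simple e) y -> mink x y \is a Num.int.
Proof.
move=> Lx /root_latticeP[k ki ->]; rewrite /comb mink_sumr.
apply: rpred_sum => i _; rewrite !minkZr rpredM // mulrAC minkC.
exact: pairing_int.
Qed.

End Dual.

(** * Recognizing real roots from the two lattices *)

Section Chamber.
Variables (R : realType) (n : nat) (e p : 'I_n.+1 -> 'rV[R]_n.+1).
Implicit Types (x y u v : 'rV[R]_n.+1) (k l a b : 'I_n.+1 -> R).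

(** The vectors [e] are outward normals, and the vertices [p] are, up to
    negative factors, the dual basis.  Hence the coefficients of a vector on
    [e] are computed by pairing with [p]. *)
Definition simplicial_chamber : Prop :=
  [/\ forall i, future (p i),
      forall i j, i != j -> mink (p i) (e j) = 0
    & forall i, mink (p i) (e i) < 0].

Hypothesis pe : simplicial_chamber.

Let pfut i : future (p i). Proof. by case: pe. Qed.
Let pe0 i j : i != j -> mink (p i) (e j) = 0.
Proof. by case: pe => _ + _; apply. Qed.
Let pelt i : mink (p i) (e i) < 0. Proof. by case: pe. Qed.

Lemma mink_vertex_comb i k : mink (p i) (comb e k) = k i * mink (p i) (e i).
Proof.
rewrite /comb mink_sumr (bigD1 i) //= minkZr big1 ?addr0 // => j nj.
by rewrite minkZr pe0 ?mulr0 // eq_sym.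
Qed.

Lemma comb_inj k l : comb e k = comb e l -> k =1 l.
Proof.
move=> ekl i; have := congr1 (mink (p i)) ekl; rewrite !mink_vertex_comb.
by apply: mulIf; rewrite lt_eqF.
Qed.

(** The omitted index [j] makes the combination orthogonal to the vertex
    [p j], and the orthogonal complement of a vertex is positive semidefinite.
    This is why the proper subdiagrams are of finite or affine type. *)
Lemma proper_comb_ge0 k j : k j = 0 -> 0 <= mink (comb e k) (comb e k).
Proof.
move=> kj; apply: (@future_orth _ _ (p j)) => //.
by rewrite ?mink_vertex_comb ?kj ?mul0r.
Qed.

Lemma vertices_free i j s t : i != j -> s *: p i = t *: p j -> s = 0.
Proof.
move=> ij est.
have pji : mink (p j) (e i) = 0 by apply: pe0; rewrite eq_sym.
have := congr1 (fun v => mink v (e i)) est.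
rewrite !minkZl pji mulr0 => /eqP.
by rewrite mulf_eq0 [X in _ || X]lt_eqF // orbF => /eqP.
Qed.

Hypothesis obtuse : forall i j, i != j -> mink (e i) (e j) <= 0.

(** Each omitted index puts a null combination on the line of the corresponding
    vertex, and distinct vertices span distinct lines.  So only one index can be
    omitted: this is the fact that the affine subdiagrams of a hyperbolic
    diagram omit a single node. *)
Lemma null_comb_full k i0 j : k i0 != 0 -> k j = 0 ->
  mink (comb e k) (comb e k) = 0 ->
  forall i, i != j -> k i != 0.
Proof.
move=> k0 kj kk i ij; apply/eqP => ki.
have orth m : k m = 0 -> exists t, comb e k = t *: p m.
  by move=> km; apply: future_orth_null; rewrite ?mink_vertex_comb ?km ?mul0r.
have [t et] := orth j kj; have [s es] := orth i ki.
have s0 : s = 0 by apply: (vertices_free ij (t := t)); rewrite -es.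
have := mink_vertex_comb i0 k; rewrite es s0 scale0r mink0r.
by move/esym/eqP; rewrite mulf_eq0 (negbTE k0) lt_eqF.
Qed.

(** A null combination is a nonzero multiple of the vertex [p j], which is not
    orthogonal to [e j]; the sign comes from the obtuse angles. *)
Lemma null_comb_lt0 k i0 j : k i0 != 0 -> k j = 0 -> (forall i, 0 <= k i) ->
  mink (comb e k) (comb e k) = 0 -> mink (comb e k) (e j) < 0.
Proof.
move=> k0 kj kge kk; rewrite lt_neqAle; apply/andP; split.
  have [t et] : exists t, comb e k = t *: p j.
    by apply: future_orth_null; rewrite ?mink_vertex_comb ?kj ?mul0r.
  rewrite et minkZl; apply: mulf_neq0; last by rewrite lt_eqF.
  apply/eqP => t0; have := mink_vertex_comb i0 k; rewrite et t0 scale0r mink0r.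
  by move/esym/eqP; rewrite mulf_eq0 (negbTE k0) lt_eqF.
rewrite /comb mink_suml; apply: sumr_le0 => i _; rewrite minkZl.
have [->|ij] := eqVneq i j; first by rewrite kj mul0r.
by rewrite mulr_ge0_le0 ?obtuse.
Qed.

Hypothesis ecr : crystallographic e.
Let epos i : 0 < mink (e i) (e i). Proof. exact: ecr.1. Qed.
Let enz i : mink (e i) (e i) != 0. Proof. by rewrite gt_eqF. Qed.

(** For [x = comb e k] in the root lattice, the second integrality condition
    says that [(2 / N) x] lies in the dual lattice.  Both conditions bear on one
    coefficient at a time, so they pass to the positive and negative parts of
    [k]. *)
Definition admissible (N : R) k : Prop :=
  forall i, k i \is a Num.int /\ k i * mink (e i) (e i) / N \is a Num.int.

Lemma admissible_coord N x : 0 < N -> root_lattice e x ->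
  root_lattice (dual_simple e) ((2 / N) *: x) ->
  exists2 k, admissible N k & x = comb e k.
Proof.
move=> N0 /root_latticeP[k ki xk] /root_latticeP[l li xl].
exists k => // i; split=> //.
suff -> : k i * mink (e i) (e i) / N = l i by [].
have : comb e (fun i => 2 / N * k i) =
    comb e (fun i => l i * (2 / mink (e i) (e i))).
  rewrite -[LHS](_ : (2 / N) *: x = _).
    by rewrite xl; apply: eq_bigr => j _; rewrite scalerA.
  by rewrite xk scaler_sumr; apply: eq_bigr => j _; rewrite scalerA.
move/comb_inj/(_ i) => ekl.
have N0' : N != 0 by rewrite gt_eqF.
have {}ekl : k i = l i * N / mink (e i) (e i).
  have -> : k i = (2 / N * k i) * (N / 2) by field.
  by rewrite ekl; field.
by rewrite ekl; field; rewrite N0' enz.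
Qed.

(** By induction on the number of terms: [(x + y|x + y) / N] differs from
    [(x|x) / N + (y|y) / N] by the pairing of [x] with [(2 / N) y], an element
    of the root lattice against one of the dual lattice. *)
Lemma admissible_sq N k : 0 < N -> admissible N k ->
  mink (comb e k) (comb e k) / N \is a Num.int.
Proof.
move=> N0 ak; have N0' : N != 0 by rewrite gt_eqF.
suff [_ _] : [/\ root_lattice e (comb e k),
  root_lattice (dual_simple e) ((2 / N) *: comb e k)
  & mink (comb e k) (comb e k) / N \is a Num.int] by [].
apply: (@big_ind _ (fun v => [/\ root_lattice e v,
  root_lattice (dual_simple e) ((2 / N) *: v) & mink v v / N \is a Num.int])).
- split; rewrite ?scaler0 ?mink0l ?mul0r ?rpred0 //;
    exact: (root_lattice_group _).1.
- move=> x y [Lx Dx ix] [Ly Dy iy]; split.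
  + exact: additive_subgroupD (root_lattice_group _) Lx Ly.
  + by rewrite scalerDr; exact: additive_subgroupD (root_lattice_group _) Dx Dy.
  + have -> : mink (x + y) (x + y) / N =
       mink x x / N + mink y y / N + mink x ((2 / N) *: y).
      by rewrite !(minkDl, minkDr, minkZr) (minkC y x); field.
    by rewrite !rpredD // (pairing_dual_int ecr).
- move=> i _; have [ki li] := ak i; split.
  + by apply: root_lattice_scale => //; exact: root_lattice_gen.
  + suff -> : (2 / N) *: (k i *: e i) =
       (k i * mink (e i) (e i) / N) *: dual_simple e i.
      by apply: root_lattice_scale => //; exact: root_lattice_gen.
    by rewrite /dual_simple !scalerA; congr (_ *: _); field; rewrite N0' enz.
  + have -> : mink (k i *: e i) (k i *: e i) / N =
       k i * (k i * mink (e i) (e i) / N) by rewrite minkZl minkZr; ring.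
    by rewrite rpredM.
Qed.

(** The situation to be excluded: the positive part [a] and the negative part
    [b] of a vector of square [N] are both nonzero. *)
Section MixedSigns.
Variables (N : R) (a b : 'I_n.+1 -> R) (i0 j0 : 'I_n.+1).
Hypotheses (N0 : 0 < N) (a0 : forall i, 0 <= a i) (b0 : forall i, 0 <= b i)
  (ab : forall i, a i * b i = 0) (aN : admissible N a) (bN : admissible N b)
  (ai0 : a i0 != 0) (bj0 : b j0 != 0)
  (NE : N = mink (comb e a - comb e b) (comb e a - comb e b)).

Let aj0 : a j0 = 0.
Proof. by have /eqP := ab j0; rewrite mulf_eq0 (negbTE bj0) orbF => /eqP. Qed.

(** If [a] were null it would involve every simple root but [e j0], leaving
    for [b] a multiple of [e j0].  Then [(b|b)] is a positive multiple of [N]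
    while [(a|b) < 0], so the square of [a - b] exceeds [N]. *)
Lemma pos_part_not_null : mink (comb e a) (comb e a) != 0.
Proof.
apply/eqP => aa.
have full := null_comb_full ai0 aj0 aa.
have neg := null_comb_lt0 ai0 aj0 a0 aa.
have bE : comb e b = b j0 *: e j0.
  rewrite /comb (bigD1 j0) //= big1 ?addr0 // => i /full ai.
  have /eqP := ab i; rewrite mulf_eq0 (negbTE ai) /= => /eqP ->.
  by rewrite scale0r.
have bpos : 0 < b j0 by rewrite lt0r bj0 b0.
have bb : 0 < mink (comb e b) (comb e b).
  by rewrite bE minkZl minkZr !mulr_gt0.
have := int_ge1 (divr_gt0 bb N0) (admissible_sq N0 bN).
rewrite ler_pdivlMr // mul1r.
have : b j0 * mink (comb e a) (e j0) < 0 by rewrite pmulr_rlt0.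
have : mink (comb e a) (comb e b) = b j0 * mink (comb e a) (e j0).
  by rewrite bE minkZr.
move: NE; rewrite !(minkBl, minkBr) (minkC (comb e b)) aa; lra.
Qed.

Lemma mink_disjoint_le0 : mink (comb e a) (comb e b) <= 0.
Proof.
rewrite {1}/comb mink_suml; apply: sumr_le0 => i _.
rewrite minkZl /comb mink_sumr mulr_sumr; apply: sumr_le0 => j _.
rewrite minkZr; have [->|ij] := eqVneq i j; first by rewrite mulrA ab mul0r.
by rewrite mulr_ge0_le0 // mulr_ge0_le0 // obtuse.
Qed.

Lemma norm_le_pos_part : N <= mink (comb e a) (comb e a).
Proof.
have aa0 : 0 < mink (comb e a) (comb e a).
  by rewrite lt0r pos_part_not_null (proper_comb_ge0 aj0).
have := int_ge1 (divr_gt0 aa0 N0) (admissible_sq N0 aN).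
by rewrite ler_pdivlMr // mul1r.
Qed.

End MixedSigns.

Lemma admissible_sign N k : 0 < N -> admissible N k ->
  N = mink (comb e k) (comb e k) ->
  (forall i, 0 <= k i) \/ (forall i, k i <= 0).
Proof.
move=> N0 kN NE.
have [[i0 ki0]|neg] := pselect (exists i, 0 < k i); last first.
  by right=> i; rewrite leNgt; apply/negP => ki; apply: neg; exists i.
have [[j0 kj0]|pos] := pselect (exists j, k j < 0); last first.
  by left=> i; rewrite leNgt; apply/negP => ki; apply: pos; exists i.
pose a i := if 0 <= k i then k i else 0.
pose b i := if 0 <= k i then 0 else - k i.
have a0 i : 0 <= a i by rewrite /a; case: ifP.
have b0 i : 0 <= b i.
  by rewrite /b; case: ifPn => //; rewrite -ltNge => /ltW; rewrite oppr_ge0.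
have ab i : a i * b i = 0 by rewrite /a /b; case: ifP; rewrite ?mulr0 ?mul0r.
have ba i : b i * a i = 0 by rewrite mulrC.
have aN : admissible N a.
  by move=> i; rewrite /a; case: ifP => _ //; rewrite !mul0r !rpred0.
have bN : admissible N b.
  by move=> i; rewrite /b; case: ifP => _; rewrite ?mul0r ?mulNr ?rpredN ?rpred0.
have ai0 : a i0 != 0 by rewrite /a ltW // gt_eqF.
have bj0 : b j0 != 0 by rewrite /b leNgt kj0 /= oppr_eq0 lt_eqF.
have kE : comb e k = comb e a - comb e b.
  rewrite /comb -sumrB; apply: eq_bigr => i _; rewrite -scalerBl; congr (_ *: _).
  by rewrite /a /b; case: ifP; rewrite ?subr0 // sub0r opprK.
have NE1 : N = mink (comb e a - comb e b) (comb e a - comb e b) by rewrite -kE.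
have NE2 : N = mink (comb e b - comb e a) (comb e b - comb e a).
  by rewrite NE1 -opprB minkNl minkNr opprK.
have A := norm_le_pos_part N0 a0 b0 ab aN bN ai0 bj0 NE1.
have B := norm_le_pos_part N0 b0 a0 ba bN aN bj0 ai0 NE2.
have C := mink_disjoint_le0 a0 b0 ab.
exfalso; move: NE1 N0; rewrite !(minkBl, minkBr) (minkC (comb e b) (comb e a)).
lra.
Qed.

(** Descent on the height [\sum_i k i].  As [(x|x) > 0], some simple root
    [e i] occurring in [x] pairs positively with [x], and reflecting in it
    lowers the height.  By [admissible_sign] the reflected vector is again
    nonnegative, or else nonpositive, in which case [x] is a multiple of
    [e i], and the coroot condition forces the multiple to be [1]. *)
Lemma real_root_nneg (m : nat) k x : x = comb e k -> (forall i, 0 <= k i) ->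
  root_lattice e x -> 0 < mink x x ->
  root_lattice (dual_simple e) ((2 / mink x x) *: x) ->
  \sum_i k i < m%:R -> real_roots e x.
Proof.
elim: m k x => [|m IH] k x xk k0 Lx x0 Dx.
  by rewrite ltNge sumr_ge0.
move=> ht.
have [k' kN xk'] := admissible_coord x0 Lx Dx.
have {k' xk'}kN : admissible (mink x x) k.
  move=> i; have <- : k' i = k i by apply: comb_inj; rewrite -xk.
  exact: kN.
have [i ki] : exists i, 0 < k i * mink x (e i).
  apply: contrapT => H; move: x0; rewrite {2}xk /comb mink_sumr ltNge.
  move/negP; apply; apply: sumr_le0 => i _; rewrite minkZr leNgt.
  by apply/negP => ki; apply: H; exists i.
have ki0 : 0 < k i.
  by rewrite lt0r k0 andbT; apply: contraTneq ki => ->; rewrite mul0r ltxx.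
have xi : 0 < mink x (e i) by rewrite -(pmulr_rgt0 _ ki0).
pose c := 2 * mink x (e i) / mink (e i) (e i).
have c0 : 0 < c by rewrite divr_gt0 // mulr_gt0.
have ci : c \is a Num.int by rewrite /c minkC pairing_int.
pose y := x *m refl (e i).
pose l j := k j - (if j == i then c else 0).
have yl : y = comb e l.
  rewrite /y reflE -/c {1}xk /comb; under [RHS]eq_bigr do rewrite scalerBl.
  rewrite sumrB; congr (_ - _).
  rewrite (bigD1 i) //= eqxx big1 ?addr0 // => j /negbTE ->.
  by rewrite scale0r.
have yy : mink y y = mink x x by rewrite refl_mink.
have Ly : root_lattice e y by exact: root_lattice_refl.
have Dy : root_lattice (dual_simple e) ((2 / mink y y) *: y).
  rewrite yy /y scalemxAl -(refl_dual ecr); apply: root_lattice_refl => //.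
  exact: dual_crystallographic.
have y0 : 0 < mink y y by rewrite yy.
have [l' lN yl'] := admissible_coord y0 Ly Dy.
have {l' yl'}lN : admissible (mink y y) l.
  move=> j; have <- : l' j = l j by apply: comb_inj; rewrite -yl.
  exact: lN.
have [l0|l0] : (forall j, 0 <= l j) \/ (forall j, l j <= 0).
- by apply: (admissible_sign y0 lN); rewrite -yl.
- have [j [w [Ww yw]]] : real_roots e y.
    apply: (IH l) => //; rewrite /l sumrB -big_mkcond /= big_pred1_eq ltrBlDr.
    by rewrite (lt_le_trans ht) // -natr1 lerD2l int_ge1.
  exists j, (w * refl (e i)); split.
    by apply: (weylM ecr) => //; exact: weyl_refl.
  by rewrite mulmxA -yw /y -mulmxA -[_ *m refl _]/(_ * _) reflK // mulmx1.
(* Only the coefficient on [e i] has changed, so the others are both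
   nonnegative and nonpositive. *)
have kj j : j != i -> k j = 0.
  move=> ji; apply/eqP; rewrite eq_le k0 andbT.
  by have := l0 j; rewrite /l (negbTE ji) subr0.
have xE : x = k i *: e i.
  rewrite xk /comb (bigD1 i) //= big1 ?addr0 // => j /kj ->.
  by rewrite scale0r.
have [kint kV] := kN i.
have k1 : k i = 1.
  apply: int_inv_int => //.
  suff <- : k i * mink (e i) (e i) / mink x x = (k i)^-1 by [].
  by rewrite xE minkZl minkZr; field; rewrite enz gt_eqF.
exists i, 1; split; first by have [_] := weyl_subgroup ecr.
by rewrite xE k1 scale1r mulmx1.
Qed.

Lemma real_root_criterion x : root_lattice e x -> 0 < mink x x ->
  root_lattice (dual_simple e) ((2 / mink x x) *: x) -> real_roots e x.
Proof.
have main k z : z = comb e k -> (forall i, 0 <= k i) ->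
  root_lattice e z -> 0 < mink z z ->
  root_lattice (dual_simple e) ((2 / mink z z) *: z) -> real_roots e z.
  move=> zk k0 Lz z0 Dz.
  apply: (@real_root_nneg (Num.trunc (\sum_i k i)).+1 k) => //.
  by rewrite truncnS_gt // sumr_ge0.
move=> Lx x0 Dx; have [k kN xk] := admissible_coord x0 Lx Dx.
have [k0|k0] : (forall j, 0 <= k j) \/ (forall j, k j <= 0).
- by apply: (admissible_sign x0 kN); rewrite -xk.
- exact: main xk k0 _ _ _.
have xx : mink (- x) (- x) = mink x x by rewrite minkNl minkNr opprK.
have [|||||j [w [Ww xw]]] := main (fun i => - k i) (- x).
- by rewrite xk /comb -sumrN; apply: eq_bigr => i _; rewrite scaleNr.
- by move=> i; rewrite oppr_ge0.
- by rewrite -scaleN1r; apply: root_lattice_scale => //; rewrite rpredN1.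
- by rewrite xx.
- by rewrite xx scalerN -scaleN1r; apply: root_lattice_scale; rewrite ?rpredN1.
exists j, (refl (e j) * w); split.
  by apply: (weylM ecr) => //; exact: weyl_refl.
by rewrite mulmxA refl_self // mulNmx -xw opprK.
Qed.

End Chamber.

(** * Facets of simplices and their normals *)

Section Simplices.
Variables (R : realType) (n : nat) (p : 'I_n.+1 -> 'rV[R]_n.+1).
Hypotheses (n2 : (2 <= n)%N) (pfut : forall i, future (p i))
  (pfree : row_free (\matrix_i p i)).

Lemma vertices_independent i j s t : i != j -> s *: p i = t *: p j -> s = 0.
Proof.
move=> ij est.
pose d : 'rV[R]_n.+1 := s *: delta_mx 0 i - t *: delta_mx 0 j.
have : d *m (\matrix_i p i) = 0.
  by rewrite mulmxBl -!scalemxAl -!rowE !rowK est subrr.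
move/eqP; rewrite mulmx_free_eq0 // => /eqP /rowP /(_ i).
by rewrite !mxE !eqxx (negbTE ij) !mulr0 mulr1 subr0.
Qed.

Lemma mink_vertices_lt0 i j : i != j -> mink (p i) (p j) < 0.
Proof.
move=> ij; have [le0 eq0] := future_mink (pfut i) (pfut j).
rewrite lt_neqAle le0 andbT; apply/eqP => /eq0[t pj].
have : (1 : R) = 0.
  apply: (@vertices_independent j i 1 t); first by rewrite eq_sym.
  by rewrite scale1r.
by move/eqP; rewrite oner_eq0.
Qed.

Lemma third_index (i j : 'I_n.+1) : exists2 k, k != i & k != j.
Proof.
have : (0 < #|~: [set i; j]|)%N.
  rewrite lt0n; apply/eqP => c0.
  have := cardsC [set i; j]; rewrite card_ord cards2 c0 addn0 => -[ijn].
  by move: n2; rewrite -ijn; case: (i != j).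
move=> /card_gt0P[k]; rewrite !inE negb_or => /andP[ki kj].
by exists k.
Qed.

(** Vertices may be ideal, hence outside of hyperbolic space; but any positive
    combination of two of them is timelike, and can be normalized to a point of
    the simplex. *)
Lemma segment_point i k s t : i != k -> 0 < s -> 0 < t ->
  exists2 a, 0 < a & exists c, [/\ forall l, 0 <= c l,
    forall l, l != i -> l != k -> c l = 0,
    a *: (s *: p i + t *: p k) = \sum_l c l *: p l
    & hyp (a *: (s *: p i + t *: p k))].
Proof.
move=> ik s0 t0; set q := _ + _.
have qq : mink q q < 0.
  rewrite /q !(minkDl, minkDr, minkZl, minkZr) (minkC (p k)).
  have := mink_vertices_lt0 ik; have [pi _] := pfut i; have [pk _] := pfut k.
  move=> pik; have st : 0 < s * t by rewrite mulr_gt0.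
  have : s * t * mink (p i) (p k) < 0 by rewrite pmulr_rlt0.
  have : s ^+ 2 * mink (p i) (p i) <= 0 by rewrite mulr_ge0_le0 ?sqr_ge0.
  have : t ^+ 2 * mink (p k) (p k) <= 0 by rewrite mulr_ge0_le0 ?sqr_ge0.
  lra.
have q0 : 0 < q 0 ord_max.
  by rewrite !mxE addr_gt0 // mulr_gt0 // (pfut _).2.
have rq : 0 < Num.sqrt (- mink q q) by rewrite sqrtr_gt0 oppr_gt0.
exists (Num.sqrt (- mink q q))^-1; first by rewrite invr_gt0.
set a := _^-1; have a0 : 0 < a by rewrite invr_gt0.
exists (fun l => a * ((if l == i then s else 0) + (if l == k then t else 0))).
split.
- move=> l; rewrite mulr_ge0 ?(ltW a0) // addr_ge0 //.
    by case: ifP => // _; exact: ltW.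
  by case: ifP => // _; exact: ltW.
- by move=> l /negbTE -> /negbTE ->; rewrite addr0 mulr0.
- under [RHS]eq_bigr do rewrite -scalerA scalerDl scalerDr.
  rewrite big_split /= (bigD1 i) //= eqxx big1 => [|l /negbTE ->].
    rewrite (bigD1 k) //= eqxx big1 => [|l /negbTE ->].
      by rewrite !addr0 -scalerDr.
    by rewrite scale0r scaler0.
  by rewrite scale0r scaler0.
- split; last by rewrite mxE mulr_gt0.
  rewrite minkZl minkZr mulrA -expr2 /a exprVn sqr_sqrtr ?oppr_ge0 ?ltW //.
  by rewrite invrN mulNr mulVf // lt_eqF.
Qed.

(** A normal is orthogonal to the points of the facet, none of which need be a
    vertex; two points of the same edge, with weights [(1, 1)] and [(2, 1)],
    suffice to reach its ends.  The facet contains an edge because [2 <= n]. *)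
Lemma outward_normal_vertices j u : outward_normal p j u ->
  (forall i, i != j -> mink (p i) u = 0) /\ mink (p j) u < 0.
Proof.
move=> [uu fu hu].
have orth i : i != j -> mink (p i) u = 0.
  move=> ij; have [k ki kj] := third_index i j.
  have ik : i != k by rewrite eq_sym.
  have on s t : 0 < s -> 0 < t -> s * mink (p i) u + t * mink (p k) u = 0.
    move=> s0 t0; have [a a0 [c [c0 cl cE xh]]] := segment_point ik s0 t0.
    have /fu : facet p j (a *: (s *: p i + t *: p k)).
      split=> //; exists c => //; split=> //; apply: cl; by rewrite eq_sym.
    rewrite minkZl => /eqP; rewrite mulf_eq0 gt_eqF //= => /eqP.
    by rewrite minkDl !minkZl.
  have := on 1 1 ltr01 ltr01; have := on 2 1 (ltr0Sn R 1) ltr01; lra.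
split=> //; rewrite lt_neqAle; apply/andP; split.
  apply/eqP => uj; move: uu.
  rewrite (mink_basis_eq0 pfree (v := u)) ?mink0l ?ltxx // => i.
  by have [->|/orth] := eqVneq i j.
have [k kj _] := third_index j j.
have jk : j != k by rewrite eq_sym.
have [a a0 [c [c0 cl cE xh]]] := segment_point jk ltr01 ltr01.
have /hu : hull p (a *: (1 *: p j + 1 *: p k)) by split=> //; exists c.
by rewrite minkZl pmulr_rle0 // minkDl !minkZl (orth _ kj) !mul1r addr0.
Qed.

Lemma outward_normal_unique j u v : outward_normal p j u ->
  outward_normal p j v -> exists2 c, 0 < c & v = c *: u.
Proof.
move=> /outward_normal_vertices[u0 uj] /outward_normal_vertices[v0 vj].
exists (mink (p j) v / mink (p j) u); first by rewrite nmulr_rgt0 ?invr_lt0.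
apply/eqP; rewrite -subr_eq0; apply/eqP; apply: (mink_basis_eq0 pfree) => i.
rewrite minkBr minkZr; have [->|ij] := eqVneq i j.
  by rewrite divfK ?subrr // lt_eqF.
by rewrite (u0 _ ij) (v0 _ ij) mulr0 subrr.
Qed.

End Simplices.

Lemma acos_pihalf (R : realType) (x : R) : -1 <= x <= 1 ->
  acos x <= pi / 2 -> 0 <= x.
Proof.
move=> x1 xpi; have [/andP[a0 _] <-] := acos_def x1.
apply: cos_ge0_pihalf; rewrite xpi andbT (le_trans _ a0) // oppr_le0.
by rewrite divr_ge0 // pi_ge0.
Qed.

(** The arccosine only carries information on [[-1, 1]].  The facets share a
    vertex because [2 <= n], so their normals lie in a positive semidefinite
    subspace, and the Cauchy-Schwarz inequality puts the cosine in that
    interval. *)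
Lemma coxeter_simplex_obtuse (R : realType) (n : nat)
    (p : 'I_n.+1 -> 'rV[R]_n.+1) i j u v : (2 <= n)%N -> coxeter_simplex p ->
  i != j -> outward_normal p i u -> outward_normal p j v -> mink u v <= 0.
Proof.
move=> n2 [pfut pfree ang] ij iu jv.
have [uu _ _] := iu; have [vv _ _] := jv.
have [k ki kj] := third_index n2 i j.
have ku := (outward_normal_vertices n2 pfut pfree iu).1 _ ki.
have kv := (outward_normal_vertices n2 pfut pfree jv).1 _ kj.
have cs : mink u v ^+ 2 <= mink u u * mink v v.
  pose w := mink v v *: u - mink u v *: v.
  have : 0 <= mink w w.
    apply: (future_orth (pfut k)).
    by rewrite /w minkBr !minkZr ku kv !mulr0 subrr.
  rewrite /w !(minkBl, minkBr, minkZl, minkZr) (minkC v u) => h.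
  rewrite -subr_ge0 -(pmulr_rge0 _ vv); lra.
pose r := Num.sqrt (mink u u) * Num.sqrt (mink v v).
have r0 : 0 < r by rewrite mulr_gt0 // sqrtr_gt0.
have rr : r ^+ 2 = mink u u * mink v v by rewrite exprMn !sqr_sqrtr // ltW.
have x1 : -1 <= - mink u v / r <= 1.
  rewrite ler_pdivlMr // ler_pdivrMr // mulN1r mul1r -ler_norml normrN.
  rewrite -ler_sqr ?nnegrE ?normr_ge0 ?(ltW r0) //.
  by rewrite -normrX ger0_norm ?sqr_ge0 // rr.
have api : acos (- mink u v / r) <= pi / 2.
  have := pi_gt0 R; have [|[_]] := ang i j u v ij iu jv.
    rewrite /dihedral_angle -/r !inE => /or4P[] /eqP ->; lra.
  by rewrite /dihedral_angle -/r => ->; lra.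
have := acos_pihalf x1 api.
by rewrite pmulr_lge0 ?invr_gt0 // oppr_ge0.
Qed.

Theorem theorem1 (R : realType) (n : nat) (hn : (2 <= n)%N)
    (F F1 : 'I_n.+1 -> 'rV[R]_n.+1)
    (hF : coxeter_simplex F) (hF1 : coxeter_simplex F1)
    (hsub : simplex_group F1 `<=` simplex_group F)
    (hmax : maximal_proper_reflection_subgroup
              (simplex_group F1) (simplex_group F))
    (A : 'M[int]_n.+1) (alpha : 'I_n.+1 -> 'rV[R]_n.+1)
    (hDelta : hyperbolic_root_system A alpha)
    (hfund : fundamental_simplex alpha F) :
  lattice (facet_roots alpha F1) `<` root_lattice alpha \/
  lattice (facet_roots (dual_simple alpha) F1) `<`
    root_lattice (dual_simple alpha).
Proof.
have [_ afree apos Aint] := hDelta.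
have [Ffut Ffree _] := hF; have [F1fut F1free _] := hF1.
have acr : crystallographic alpha.
  by split=> // i j; rewrite -Aint; apply/intrP; exists (A i j).
have adcr := dual_crystallographic acr.
have sublat e : crystallographic e ->
    lattice (facet_roots e F1) `<=` root_lattice e.
  move=> ecr; apply: smallest_sub; first exact: root_lattice_group.
  by move=> b [rb _]; exact: real_root_lattice.
apply: contrapT => /not_orP[nL nLd].
have {nL}L : root_lattice alpha `<=` lattice (facet_roots alpha F1).
  by apply: contrapT => H; apply: nL; split; [exact: sublat|].
have {nLd}Ld : root_lattice (dual_simple alpha) `<=`
    lattice (facet_roots (dual_simple alpha) F1).
  by apply: contrapT => H; apply: nLd; split; [exact: sublat|].
(* A facet [j] without a root would leave the vertex [F1 j] orthogonal to all
   facet roots, hence to [L], which spans. *)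
have /choice[beta betaP] : forall j, exists b,
    real_roots alpha b /\ outward_normal F1 j b.
  move=> j; apply: contrapT => nb.
  have orth x : root_lattice alpha x -> mink (F1 j) x = 0.
    move=> /L /(_ [set y | mink (F1 j) y = 0]); apply; split.
      split=> [|y z /= Fy Fz]; first exact: mink0r.
      by rewrite /= minkBr Fy Fz subrr.
    move=> b [rb [i ib]] /=.
    apply: (outward_normal_vertices hn F1fut F1free ib).1.
    by apply/eqP => ji; apply: nb; exists b; rewrite ji.
  have F1j : F1 j = 0.
    apply: (mink_basis_eq0 afree) => i; rewrite minkC; apply: orth.
    exact: root_lattice_gen.
  by have [_] := F1fut j; rewrite F1j mxE ltxx.
have betar j := (betaP j).1; have betan j := (betaP j).2.
have uniq b j : real_roots alpha b -> outward_normal F1 j b -> b = beta j.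
  move=> rb nb.
  have [c c0 bE] := outward_normal_unique hn F1fut F1free (betan j) nb.
  rewrite bE; rewrite bE in rb.
  by rewrite (real_root_unique acr afree c0 (betar j) rb) scale1r.
have {}L : root_lattice alpha `<=` root_lattice beta.
  apply: (subset_trans L); apply: smallest_sub; first exact: root_lattice_group.
  by move=> b [rb [j nb]]; rewrite (uniq _ _ rb nb); exact: root_lattice_gen.
have {}Ld : root_lattice (dual_simple alpha) `<=` root_lattice (dual_simple beta).
  apply: (subset_trans Ld); apply: smallest_sub; first exact: root_lattice_group.
  move=> b [/(dual_real_root acr)[r rr ->] [j nb]].
  (* [r] and [beta j] are real roots on the same facet, but only the coroot of
     [r] is known to be an outward normal. *)
  suff -> : r = beta j by exact: root_lattice_gen.
  have r0 := real_root_pos acr rr.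
  have [c c0 bE] := outward_normal_unique hn F1fut F1free nb (betan j).
  have rb := betar j; rewrite bE scalerA in rb.
  rewrite bE scalerA (real_root_unique acr afree _ rr rb) ?scale1r //.
  by rewrite mulr_gt0 // divr_gt0.
have bcr : crystallographic beta.
  split=> [i|i j]; first exact: (real_root_pos acr (betar i)).
  by apply: (real_root_pairing acr (betar i)); exact: real_root_lattice.
have bch : simplicial_chamber beta F1.
  split=> // [i j ij|i].
    exact: (outward_normal_vertices hn F1fut F1free (betan j)).1.
  exact: (outward_normal_vertices hn F1fut F1free (betan i)).2.
have bobt i j : i != j -> mink (beta i) (beta j) <= 0.
  by move=> ij; apply: (coxeter_simplex_obtuse hn hF1 ij).
have arb i : real_roots beta (alpha i).
  apply: (real_root_criterion bch bobt bcr) => //.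
    by apply: L; exact: root_lattice_gen.
  by apply: Ld; exact: root_lattice_gen.
have wsub : weyl_group beta `<=` simplex_group F1.
  apply: smallest_sub.
    apply: generated_subgroup => _ [u [j [u0 _ _]] <-].
    by rewrite refl_unit ?gt_eqF.
  by move=> _ [j _ <-]; apply: generated_sub; exists (beta j) => //; exists j.
have [_ [_ nsub] _] := hmax; apply: nsub.
apply: subset_trans wsub; apply: smallest_sub; first exact: weyl_subgroup.
move=> _ [u [j nu] <-].
have [c c0 ->] := outward_normal_unique hn Ffut Ffree (hfund j) nu.
by rewrite reflZ ?gt_eqF //; exact: real_root_refl.
Qed.
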